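(* There exists a finite convex geometry $(X,\varphi)$ of convex dimension exactly $3$ such that, for every integer $t\ge 1$, $(X,\varphi)$ is not representable by spheres in $\mathbb{R}^t$.
   Context: A closure operator on a set $X$ is a map $\varphi:2^X\to 2^X$ with $Y\subseteq\varphi(Y)$, $Y\subseteq Z\Rightarrow\varphi(Y)\subseteq\varphi(Z)$, and $\varphi(\varphi(Y))=\varphi(Y)$; a subset $Y$ is closed if $\varphi(Y)=Y$. The family $\mathcal{F}_\varphi$ of closed sets is the closure space of $\varphi$ (a family of subsets of $X$ containing $X$ and closed under pairwise intersections; for finite $X$, closure operators and closure spaces determine each other). The pair $(X,\varphi)$, $X$ finite, is a convex geometry if $\varphi(\emptyset)=\emptyset$ and the Anti-Exchange Property holds: for every closed $Y\subseteq X$ and distinct $x,y\in X\setminus Y$, if $x\in\varphi(Y\cup\{y\})$ then $y\notin\varphi(Y\cup\{x\})$. A convex geometry is monotone if its closed sets form a chain under inclusion; equivalently its closed sets are exactly $\emptyset\subset\{x_1\}\subset\{x_1,x_2\}\subset\dots\subset\{x_1,\dots,x_n\}=X$ for some linear order $x_1<\dots<x_n$ of $X$. The join $\mathcal{F}\vee\mathcal{K}$ of two closure spaces on $X$ is the smallest closure space containing both; it equals $\{F\cap K: F\in\mathcal{F},K\in\mathcal{K}\}$. The convex dimension of a convex geometry $(X,\varphi)$ is the least $k$ such that $\mathcal{F}_\varphi$ is the join of $k$ monotone convex geometries on $X$. ''Sphere in $\mathbb{R}^t$'' means a closed (solid) Euclidean ball of radius $\ge 0$ (radius $0$ gives a point).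 Let $\mathrm{CH}$ denote the usual convex hull in $\mathbb{R}^t$. A finite convex geometry $(X,\varphi)$ is representable by spheres in $\mathbb{R}^t$ if there is an injective assignment $x\mapsto F(x)$ of spheres in $\mathbb{R}^t$ to the elements of $X$ such that for all $Y\subseteq X$, $\varphi(Y)=\{x\in X: F(x)\subseteq \mathrm{CH}(\bigcup_{y\in Y}F(y))\}$. *)

(* Defs.v *)
From mathcomp Require Import all_boot all_order all_algebra.
From mathcomp Require Import boolp classical_sets reals convex.

Set Implicit Arguments.
Unset Strict Implicit.
Unset Printing Implicit Defensive.

Import Order.TTheory GRing.Theory Num.Theory.

Local Open Scope classical_set_scope.
Local Open Scope ring_scope.

Section ConvexGeometry.
Variable X : finType.
Implicit Types (phi : {set X} -> {set X}) (Y Z : {set X}) (F : {set {set X}}).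

Definition closure_operator phi : Prop :=
  [/\ forall Y, Y \subset phi Y,
      forall Y Z, Y \subset Z -> phi Y \subset phi Z
    & forall Y, phi (phi Y) = phi Y].

Definition closed_sets phi : {set {set X}} := [set Y : {set X} | phi Y == Y]%SET.

Definition anti_exchange phi : Prop :=
  forall Y (x y : X), Y \in closed_sets phi ->
    x \notin Y -> y \notin Y -> x != y ->
    x \in phi (Y :|: [set y])%SET -> y \notin phi (Y :|: [set x])%SET.

Definition convex_geometry phi : Prop :=
  [/\ closure_operator phi, phi finset.set0 = finset.set0 & anti_exchange phi].

Definition monotone_convex_geometry phi : Prop :=
  convex_geometry phi /\
  forall Y Z, Y \in closed_sets phi -> Z \in closed_sets phi ->
    (Y \subset Z) || (Z \subset Y).

Definition closure_space F : Prop :=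
  finset.setT \in F /\
  forall Y Z, Y \in F -> Z \in F -> (Y :&: Z)%SET \in F.

Definition is_join (k : nat) (K : 'I_k -> {set {set X}}) F : Prop :=
  [/\ closure_space F,
      forall i, K i \subset F
    & forall G : {set {set X}},
        closure_space G -> (forall i, K i \subset G) -> F \subset G].

Definition join_of_monotone phi (k : nat) : Prop :=
  exists2 psi : 'I_k -> {set X} -> {set X},
    forall i, monotone_convex_geometry (psi i)
  & is_join (fun i => closed_sets (psi i)) (closed_sets phi).

Definition convex_dimension_is phi (k : nat) : Prop :=
  join_of_monotone phi k /\ forall j : nat, join_of_monotone phi j -> (k <= j)%N.

End ConvexGeometry.

Section Spheres.
Variables (R : realType) (t : nat).

(* Spelled out because the library norm on ['rV[R]_t] is the sup norm. *)
Definition euclidean_dist (x y : 'rV[R]_t) : R :=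
  Num.sqrt (\sum_(i < t) (x ord0 i - y ord0 i) ^+ 2).

(* "Spheres" are solid; radius 0 gives a point. *)
Definition solid_sphere (c : 'rV[R]_t) (r : R) : set 'rV[R]_t :=
  [set x | euclidean_dist x c <= r].

Definition is_sphere (S : set 'rV[R]_t) : Prop :=
  exists c : 'rV[R]_t, exists2 r : R, 0 <= r & S = solid_sphere c r.

Definition convex_hull (A : set 'rV[R]_t) : set 'rV[R]_t :=
  smallest (@convex_set R 'rV[R]_t) A.

Definition sphere_representable (X : finType) (phi : {set X} -> {set X}) : Prop :=
  exists F : X -> set 'rV[R]_t,
    [/\ forall x, is_sphere (F x),
        injective F
      & forall (Y : {set X}) (x : X),
          x \in phi Y <-> F x `<=` convex_hull (\bigcup_(y in [set` Y]) F y)].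

End Spheres.

(* Main.v *)
Require Import Defs.
From mathcomp Require Import all_boot all_order all_algebra.
From mathcomp Require Import reals.
From mathcomp Require Import zify ring lra.

(* Write [h_x(u) = <c_x, u> + r_x] for the support function of the sphere of [x].  The geometry
   is given by three linear orders [L_e]; besides points it has elements [top e], each largest
   in [L_e] and near the bottom of the other two orders.  The point [x] least in [L_e] is not in
   the closure of the two other tops, so some unit vector [u_e] has [h_x(u_e)] larger than the
   support functions of these tops; as [x], then [y], lie in the closure of [y'] and these tops
   whenever [y] is below [y'] in [L_e], the values [h_y(u_e)] are nondecreasing along [L_e].

   If [p] is in the closure of [q] then [f = h_q - h_p >= 0] on the unit sphere, and Ptolemy's
   inequality gives [w_0 f(u_0) <= 2 (w_1 f(u_1) + w_2 f(u_2))] and its cyclic analogues, where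
   [w_e] is positive and depends only on [u_0, u_1, u_2].  For each [d] there are three pairs
   [p_i <= q_i] that straddle a long gap of [L_d] but occupy disjoint intervals inside the
   corresponding gaps of the two other orders.  Summing the inequalities makes all these gaps
   vanish, and then two different elements have the same sphere. *)

Set Implicit Arguments.
Unset Strict Implicit.
Unset Printing Implicit Defensive.

Import Order.TTheory GRing.Theory Num.Theory.

(** * Convex geometries generated by injective ranks *)

Section RankClosure.
Variables (X I : finType) (rank : I -> X -> nat).
Implicit Types Y Z : {set X}.
Hypothesis rank_inj : forall i, injective (rank i).
Variable i0 : I.

(** The closed sets are the intersections of initial segments, one for each rank. *)
Definition rank_closure Y : {set X} :=
  [set x | [forall i, [exists y in Y, rank i x <= rank i y]]].

Lemma rank_closureP Y x :
  reflect (forall i, exists2 y, y \in Y & rank i x <= rank i y)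
          (x \in rank_closure Y).
Proof.
rewrite inE; apply: (iffP forallP) => h i.
  by have /exists_inP[y yY le_xy] := h i; exists y.
by apply/exists_inP; have [y] := h i; exists y.
Qed.

Lemma rank_closure_operator : closure_operator rank_closure.
Proof.
have subC Y : Y \subset rank_closure Y.
  by apply/subsetP => x xY; apply/rank_closureP => i; exists x.
split=> // [Y Z /subsetP sYZ|Y].
  apply/subsetP => x /rank_closureP h; apply/rank_closureP => i.
  by have [y /sYZ yZ le_xy] := h i; exists y.
apply/eqP; rewrite eqEsubset subC andbT; apply/subsetP => x /rank_closureP h.
apply/rank_closureP => i; have [y /rank_closureP/(_ i)[z zY le_yz] le_xy] := h i.
by exists z => //; exact: leq_trans le_yz.
Qed.

(** A point [x] outside a closed [Y] lies above all of [Y] in some rank; there the two halves of an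
    exchange would put [x] strictly below [y] and [y] below [x]. The index [i0] makes the closure of
    the empty set empty. *)
Lemma rank_convex_geometry : convex_geometry rank_closure.
Proof.
split; first exact: rank_closure_operator.
  by apply/setP => x; rewrite in_set0; apply/rank_closureP => /(_ i0)[y]; rewrite in_set0.
move=> Y x y; rewrite inE => /eqP Ycl xY yY neq_xy /rank_closureP xYy.
apply/negP => /rank_closureP yYx; move: xY; rewrite -{1}Ycl inE negb_forall.
case/existsP=> i /exists_inPn/= ltYx.
have {}ltYx z : z \in Y -> rank i z < rank i x by move=> /ltYx; rewrite -ltnNge.
have lt_xy : rank i x < rank i y.
  have [z + le_xz] := xYy i; rewrite !inE => /orP[/ltYx|/eqP zy]; first by rewrite ltnNge le_xz.
  rewrite ltn_neqAle -zy le_xz andbT zy.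
  by apply: contra_neq neq_xy => /rank_inj.
have [z + le_yz] := yYx i; rewrite !inE => /orP[/ltYx|/eqP zx].
  by move=> /(leq_ltn_trans le_yz)/(ltn_trans lt_xy); rewrite ltnn.
by move: lt_xy; rewrite ltnNge -zx le_yz.
Qed.

End RankClosure.

Lemma closed_sets_closure_space (X : finType) (phi : {set X} -> {set X}) :
  closure_operator phi -> closure_space (closed_sets phi).
Proof.
case=> ext mono idem; split.
  by rewrite inE; apply/eqP/setP => x; rewrite inE (subsetP (ext _)) ?inE.
move=> Y Z; rewrite !inE => /eqP Ycl /eqP Zcl.
by rewrite eqEsubset ext andbT subsetI -{2}Ycl -{3}Zcl !mono ?subsetIl ?subsetIr.
Qed.

Lemma rank_closure_monotone (X : finType) (rank : X -> nat) :
  injective rank ->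
  monotone_convex_geometry (rank_closure (fun _ : 'I_1 => rank)).
Proof.
move=> rank_inj; split; first exact: (rank_convex_geometry (fun=> rank_inj) ord0).
move=> Y Z; rewrite !inE => /eqP Ycl /eqP Zcl.
apply/orP; case: (boolP (Y \subset Z)) => [|/subsetPn[y yY yZ]]; [by left|right].
apply/subsetP => z zZ; rewrite -Ycl; apply/rank_closureP => _; exists y => //.
rewrite leqNgt; apply: contra yZ => lt_yz; rewrite -Zcl.
by apply/rank_closureP => _; exists z => //; exact: ltnW.
Qed.

(** A closed set is the intersection of its closures in the single orders, so it lies in every
    closure space containing these chains. *)
Lemma rank_closure_join (X : finType) (k : nat) (rank : 'I_k -> X -> nat) :
  (forall i, injective (rank i)) -> join_of_monotone (rank_closure rank) k.
Proof.
move=> rank_inj.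
pose psi i := rank_closure (fun _ : 'I_1 => rank i).
have psi_op i : closure_operator (psi i) by exact: rank_closure_operator.
have phi_op : closure_operator (rank_closure rank) by exact: rank_closure_operator.
exists psi => [i|]; first exact: rank_closure_monotone.
split; first exact: closed_sets_closure_space.
  move=> i; apply/subsetP => Y; rewrite !inE => /eqP Ycl.
  have [ext _ _] := phi_op; rewrite eqEsubset ext andbT -{2}Ycl.
  by apply/subsetP => x /rank_closureP h; apply/rank_closureP => _; exact: h.
move=> G [GT GI] sKG; apply/subsetP => Y; rewrite inE => /eqP Ycl.
suff -> : Y = \bigcap_i psi i Y.
  apply: (big_ind (fun Z => Z \in G)) => // i _; apply: (subsetP (sKG i)); rewrite inE.
  by have [_ _ idem] := psi_op i; apply/eqP.
apply/setP => x; rewrite -{1}Ycl; apply/rank_closureP/bigcapP => h i.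
  by move=> _; apply/rank_closureP => _; exact: h.
by have /rank_closureP/(_ ord0) := h i isT.
Qed.

(* In each of the [j] chains some point of [Y] generates all of [Y]; if [j < #|Y|]
   some [e] in [Y] is not among them, hence lies in the closure of the rest. *)
Lemma independent_leq_join (X : finType) (phi : {set X} -> {set X}) (Y : {set X})
    (j : nat) :
  closure_operator phi -> {in Y, forall e, e \notin phi (Y :\ e)} ->
  join_of_monotone phi j -> #|Y| <= j.
Proof.
move=> [ext mono idem] indepY [psi psi_mono [_ _ minF]].
rewrite leqNgt; apply/negP => lt_jY.
have [y0 y0Y] := card_gt0P (leq_ltn_trans (leq0n j) lt_jY).
have top_ex i : exists m, (m \in Y) && (Y \subset psi i [set m]).
  have [[[exti monoi idemi] _ _] chain] := psi_mono i.
  have [m mY max_m] := arg_maxnP (fun y => #|psi i [set y]|) y0Y.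
  exists m; rewrite [_ \in _]mY; apply/subsetP => y yY.
  have yy : y \in psi i [set y] by rewrite (subsetP (exti _)) ?inE.
  have cl z : psi i [set z] \in closed_sets (psi i) by rewrite inE idemi.
  case/orP: (chain _ _ (cl y) (cl m)) => [/subsetP/(_ _ yy)//|sub].
  suff /eqP -> : psi i [set m] == psi i [set y] by [].
  by rewrite eqEcard sub; exact: max_m.
have [m mP] := fin_all_exists top_ex.
have /subsetPn[e eY eM] : ~~ (Y \subset [set m i | i : 'I_j]).
  apply: contraL lt_jY => /subset_leq_card leY; rewrite -leqNgt.
  by apply: leq_trans leY _; rewrite -[leqRHS]card_ord leq_imset_card.
(* The sets that cannot contain the rest of [Y] without [e] form a closure space; it contains all
   the chains, but not the closure of the rest. *)
pose G := [set Z : {set X} | (Y :\ e \subset Z) ==> (e \in Z)].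
have G_space : closure_space G.
  split=> [|Z T]; first by rewrite !inE implybT.
  rewrite !inE subsetI => /implyP GZ /implyP GT; apply/implyP => /andP[].
  by move=> /GZ -> /GT ->.
have K_sub_G i : closed_sets (psi i) \subset G.
  apply/subsetP => Z; rewrite !inE => /eqP <-; apply/implyP => sYZ.
  have /andP[mY /subsetP/(_ e eY)] := mP i.
  have [[[exti monoi idemi] _ _] _] := psi_mono i.
  rewrite -(idemi Z); apply: (subsetP (monoi _ _ _)); rewrite sub1set.
  apply: (subsetP sYZ); rewrite !inE mY andbT.
  by apply: contraNneq eM => <-; exact: imset_f.
have /subsetP/(_ (phi (Y :\ e))) := minF G G_space K_sub_G.
rewrite !inE idem eqxx ext => /(_ isT).
by apply/negP/indepY.
Qed.

(** * The configuration *)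

Definition config : finType := (('I_3 * bool * 'I_3) + 'I_3)%type.

Definition pt (d : 'I_3) (s : bool) (i : 'I_3) : config := inl (d, s, i).
Definition top (d : 'I_3) : config := inr d.

(* In order [e], from bottom to top: the two other tops, the [pt e false i], the points
   [pt d s i] with [d != e] in lexicographic order of [(d, i, s)], the [pt e true i],
   and [top e]. *)
Definition config_rank (e : 'I_3) (x : config) : nat :=
  match x with
  | inl (d, s, i) => if d == e then 10 + 60 * s + i else 30 + 10 * d + 2 * i + s
  | inr d => if d == e then 100 else d
  end.

Lemma config_rank_inj e : injective (config_rank e).
Proof.
move=> [[[d s] i]|d] [[[d' s'] i']|d'] /=; have := ltn_ord d; have := ltn_ord d';
  rewrite -?(inj_eq val_inj) /=.
- have := ltn_ord i; have := ltn_ord i' => lti' lti ltd' ltd eq_rk.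
  have [/val_inj-> [-> /val_inj->]] // : val d = val d' /\ s = s' /\ val i = val i'.
  by move: eq_rk; case: eqP; case: eqP; case: s; case: s' => /=; lia.
- have := ltn_ord i; case: eqP; case: eqP; case: s => /=; lia.
- have := ltn_ord i'; case: eqP; case: eqP; case: s' => /=; lia.
- by move=> ltd' ltd eq_rk; congr inr; apply: val_inj; move: eq_rk;
    case: eqP; case: eqP => /=; lia.
Qed.

Lemma config_rank_le e x : config_rank e x <= 100.
Proof.
case: x => [[[d s] i]|d] /=; have := ltn_ord d; last by case: eqP; lia.
by have := ltn_ord i; case: eqP; case: s => /=; lia.
Qed.

Lemma config_rank_top e d : d != e -> config_rank e (top d) < 3.
Proof. by move=> /negPf ne; rewrite /= ne ltn_ord. Qed.

Lemma config_rank_topE e : config_rank e (top e) = 100.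
Proof. by rewrite /= eqxx. Qed.

Lemma config_dimension : convex_dimension_is (rank_closure config_rank) 3.
Proof.
split=> [|j joinj]; first exact: rank_closure_join config_rank_inj.
(* Each top is above the two others in its own order, so the tops are independent. *)
pose Y := [set top d | d : 'I_3].
have -> : 3 = #|Y| by rewrite card_imset ?card_ord // => d d' [].
apply: independent_leq_join joinj; first exact: rank_closure_operator.
move=> _ /imsetP[e _ ->]; apply/rank_closureP => /(_ e)[x].
rewrite !inE => /andP[+ /imsetP[d _ xE]]; rewrite xE config_rank_topE => ne.
have /config_rank_top/leq_trans lt3 : d != e by apply: contraNneq ne => ->.
by rewrite leqNgt lt3.
Qed.

Local Open Scope ring_scope.

(** * Linear inequalities between the gaps *)

Section Gaps.
(** In the application [C e x] is a positive weight times the support function of [x] at the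
    direction [u e]. The bound 10 in [C_mono] leaves out exactly the two tops at the bottom of order
    [e]. *)
Variables (R : realFieldType) (C : 'I_3 -> config -> R).
Let delta e d i := C e (pt d true i) - C e (pt d false i).
Hypothesis C_mono : forall e x y,
  (10 <= config_rank e x)%N -> (config_rank e x <= config_rank e y)%N -> C e x <= C e y.
Hypothesis delta_ptolemy : forall e d i,
  delta e d i <= 2 * (delta (e + 1) d i + delta (e + 2) d i).

Let o0 : 'I_3 := @Ordinal 3 0 isT.
Let o1 : 'I_3 := @Ordinal 3 1 isT.
Let o2 : 'I_3 := @Ordinal 3 2 isT.
Let G e := C e (pt e true o0) - C e (pt e false o2).
Let S e d := delta e d o0 + delta e d o1 + delta e d o2.

Let ord3P (P : 'I_3 -> Prop) : P o0 -> P o1 -> P o2 -> forall i, P i.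
Proof.
move=> P0 P1 P2 [[|[|[|//]]] lti];
  [have -> : Ordinal lti = o0|have -> : Ordinal lti = o1|have -> : Ordinal lti = o2];
  by [|apply: val_inj].
Qed.

Lemma gap_ge0 e : 0 <= G e.
Proof. by rewrite subr_ge0; apply: C_mono; elim/ord3P: e. Qed.

Lemma delta_ge0 e d i : 0 <= delta e d i.
Proof.
by rewrite subr_ge0; apply: C_mono; elim/ord3P: e; elim/ord3P: d; elim/ord3P: i.
Qed.

Lemma gap_le_delta e i : G e <= delta e e i.
Proof. by apply: lerB; apply: C_mono; elim/ord3P: e; elim/ord3P: i. Qed.

(** Inside the gap of order [e] the six pairs with [d != e] occupy disjoint intervals, one after the
    other. *)
Lemma gap_ge_sum e : S e (e + 1) + S e (e + 2) <= G e.
Proof.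
have step a (d i j : 'I_3) : d != a -> (i < j)%N ->
    C a (pt d true i) <= C a (pt d false j).
  move=> n l; apply: C_mono; move: n l;
    by elim/ord3P: a; elim/ord3P: d; elim/ord3P: i; elim/ord3P: j.
have lo a d : d != a -> C a (pt a false o2) <= C a (pt d false o0).
  by move=> n; apply: C_mono; move: n; elim/ord3P: a; elim/ord3P: d.
have hi a d : d != a -> C a (pt d true o2) <= C a (pt a true o0).
  by move=> n; apply: C_mono; move: n; elim/ord3P: a; elim/ord3P: d.
have mid a (d d' : 'I_3) : d != a -> d' != a -> (d < d')%N ->
    C a (pt d true o2) <= C a (pt d' false o0).
  move=> n n' l; apply: C_mono; move: n n' l;
    by elim/ord3P: a; elim/ord3P: d; elim/ord3P: d'.
have /(_ e) n1 : forall a : 'I_3, a + 1 != a by elim/ord3P.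
have /(_ e) n2 : forall a : 'I_3, a + 2 != a by elim/ord3P.
have tel d : d != e -> S e d <= C e (pt d true o2) - C e (pt d false o0).
  move=> n; have := step e d o0 o1 n isT; have := step e d o1 o2 n isT.
  by rewrite /S /delta; lra.
have := tel _ n1; have := tel _ n2; rewrite /G.
(* Indices add modulo 3, so either of [e + 1] and [e + 2] may come first. *)
have [lt12|lt21|/val_inj eq12] := ltngtP (val (e + 1)) (val (e + 2)).
- by have := mid _ _ _ n1 n2 lt12; have := lo _ _ n1; have := hi _ _ n2; lra.
- by have := mid _ _ _ n2 n1 lt21; have := lo _ _ n2; have := hi _ _ n1; lra.
- by move/addrI/(congr1 val): eq12.
Qed.

(* The gaps satisfy [3 G_d <= 2 (S_(d+1),d + S_(d+2),d)] and [S_e,(e+1) + S_e,(e+2) <= G_e],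
   so [3 (G_0 + G_1 + G_2) <= 2 (G_0 + G_1 + G_2)]. *)
Lemma delta_eq0 e d i : d != e -> delta e d i = 0.
Proof.
have gap3 a : 3 * G a <= 2 * (S (a + 1) a + S (a + 2) a).
  have := gap_le_delta a o0; have := gap_le_delta a o1; have := gap_le_delta a o2.
  have := delta_ptolemy a a o0; have := delta_ptolemy a a o1; have := delta_ptolemy a a o2.
  by rewrite /S; lra.
have S_ge0 a b : 0 <= S a b.
  by have := delta_ge0 a b o0; have := delta_ge0 a b o1; have := delta_ge0 a b o2; rewrite /S; lra.
have S0 : [/\ S o0 o1 = 0, S o0 o2 = 0 & S o1 o0 = 0] /\
           [/\ S o1 o2 = 0, S o2 o0 = 0 & S o2 o1 = 0].
  have a01 : o0 + 1 = o1 by exact: val_inj.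
  have a02 : o0 + 2 = o2 by exact: val_inj.
  have a11 : o1 + 1 = o2 by exact: val_inj.
  have a12 : o1 + 2 = o0 by exact: val_inj.
  have a21 : o2 + 1 = o0 by exact: val_inj.
  have a22 : o2 + 2 = o1 by exact: val_inj.
  have := gap3 o0; have := gap3 o1; have := gap3 o2.
  have := gap_ge_sum o0; have := gap_ge_sum o1; have := gap_ge_sum o2.
  rewrite a01 a02 a11 a12 a21 a22.
  move: (S_ge0 o0 o1) (S_ge0 o0 o2) (S_ge0 o1 o0) (S_ge0 o1 o2) (S_ge0 o2 o0) (S_ge0 o2 o1).
  move: (gap_ge0 o0) (gap_ge0 o1) (gap_ge0 o2).
  move: (S o0 o1) (S o0 o2) (S o1 o0) (S o1 o2) (S o2 o0) (S o2 o1) (G o0) (G o1) (G o2).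
  clear.
  move=> s01 s02 s10 s12 s20 s21 g0 g1 g2 *; split; split; lra.
have {}S0 : d != e -> S e d = 0.
  by case: S0 => -[? ? ?] [? ? ?]; elim/ord3P: e; elim/ord3P: d.
move=> /S0; rewrite /S.
have := delta_ge0 e d o0; have := delta_ge0 e d o1; have := delta_ge0 e d o2.
by elim/ord3P: i; lra.
Qed.

End Gaps.

(** * Euclidean balls *)

From mathcomp Require Import unstable boolp classical_sets interval_inference convex
  topology normedtype derive realfun.
Import numFieldNormedType.Exports.

Local Open Scope classical_set_scope.

Section Euclidean.
Variables (R : realType) (t : nat).
Implicit Types (u v w p : 'rV[R]_t) (k : R).

Definition dot u v : R := \sum_(i < t) u ord0 i * v ord0 i.

Lemma dotC u v : dot u v = dot v u.
Proof. by apply: eq_bigr => i _; rewrite mulrC. Qed.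

Lemma dotDl u v w : dot (u + v) w = dot u w + dot v w.
Proof. by rewrite -big_split; apply: eq_bigr => i _; rewrite mxE mulrDl. Qed.

Lemma dotZl k u v : dot (k *: u) v = k * dot u v.
Proof. by rewrite mulr_sumr; apply: eq_bigr => i _; rewrite mxE mulrA. Qed.

Lemma dotDr u v w : dot u (v + w) = dot u v + dot u w.
Proof. by rewrite ![dot u _]dotC dotDl. Qed.

Lemma dotZr k u v : dot u (k *: v) = k * dot u v.
Proof. by rewrite ![dot u _]dotC dotZl. Qed.

Lemma dotNl u v : dot (- u) v = - dot u v.
Proof. by rewrite -scaleN1r dotZl mulN1r. Qed.

Lemma dotNr u v : dot u (- v) = - dot u v.
Proof. by rewrite dotC dotNl dotC. Qed.

Lemma dot0l u : dot 0 u = 0.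
Proof. by rewrite -(scale0r 0) dotZl mul0r. Qed.

Definition dotE := (dotDl, dotDr, dotNl, dotNr, dotZl, dotZr).

Lemma dot_ge0 u : 0 <= dot u u.
Proof. by apply: sumr_ge0 => i _; rewrite -expr2 sqr_ge0. Qed.

Lemma dot_eq0 u : (dot u u == 0) = (u == 0).
Proof.
apply/eqP/eqP => [u0|->]; last first.
  by rewrite /dot big1 // => i _; rewrite mxE mul0r.
apply/rowP => i; rewrite mxE; apply/eqP; rewrite -sqrf_eq0 expr2; apply/eqP.
by apply: (psumr_eq0P _ u0) => // j _; rewrite -expr2 sqr_ge0.
Qed.

Definition enorm u : R := Num.sqrt (dot u u).

Lemma enorm_ge0 u : 0 <= enorm u.
Proof. exact: sqrtr_ge0. Qed.

Lemma sqr_enorm u : enorm u ^+ 2 = dot u u.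
Proof. by rewrite sqr_sqrtr ?dot_ge0. Qed.

Lemma enormN u : enorm (- u) = enorm u.
Proof. by rewrite /enorm !dotE opprK. Qed.

Lemma enormZ k u : enorm (k *: u) = `|k| * enorm u.
Proof. by rewrite /enorm !dotE mulrA -expr2 sqrtrM ?sqr_ge0 // sqrtr_sqr. Qed.

Lemma euclidean_distE u v : euclidean_dist u v = enorm (u - v).
Proof. by congr Num.sqrt; apply: eq_bigr => i _; rewrite !mxE -expr2. Qed.

Lemma enorm_unit u : dot u u = 1 -> enorm u = 1.
Proof. by rewrite /enorm => ->; rewrite sqrtr1. Qed.

Lemma dot_le_enorm u v : dot u u = 1 -> dot u v <= enorm v.
Proof.
move=> u1; have := dot_ge0 (v - dot u v *: u).
rewrite !dotE u1 (dotC v u) -sqr_enorm => h.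
have [|dot0] := leP (dot u v) 0; first by move=> /le_trans; apply; exact: enorm_ge0.
rewrite -ler_sqr ?nnegrE ?enorm_ge0 ?(ltW dot0) //; lra.
Qed.

(** The derivative of the norm at [m] in direction [d] is [dot m d / enorm m]; a single small step
    [e] replaces the limit. *)
Lemma enorm_first_order m d k : 0 < enorm m ->
  (forall e, 0 < e -> e <= 1 -> enorm m + e * k <= enorm (m + e *: d)) ->
  k * enorm m <= dot m d.
Proof.
move=> m0 h; rewrite leNgt; apply/negP => ltmd.
pose D := dot d d; have D0 : 0 <= D by exact: dot_ge0.
pose q := k * enorm m - dot m d; have q0 : 0 < q by rewrite subr_gt0.
(* This choice gives [e * D < q], so the quadratic term [e ^+ 2 * D] cannot make up for the deficit
   [2 * e * q]. *)
pose e := q / (q + D); have qD : 0 < q + D by rewrite ltr_wpDr.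
have e0 : 0 < e by rewrite divr_gt0.
have e1 : e <= 1 by rewrite ler_pdivrMr // mul1r lerDl.
have eE : e * q + e * D = q by rewrite -mulrDr mulfVK ?gt_eqF.
have := h e e0 e1; set x := enorm (m + _) => hx.
have x2 : x ^+ 2 = enorm m ^+ 2 + 2 * e * dot m d + e ^+ 2 * D.
  by rewrite !sqr_enorm !dotE (dotC d m) /D; ring.
(* The lower bound for [x] may be negative, so it is multiplied by [enorm m] instead of being
   squared. *)
have amgm : 0 <= (x - enorm m) ^+ 2 by rewrite sqr_ge0.
have := ler_wpM2r (ltW m0) hx.
have : e * (e * D) < 2 * e * q.
  rewrite (_ : 2 * e * q = e * (2 * q)) ?ltr_pM2l //; last by ring.
  by have := mulr_gt0 e0 q0; lra.
rewrite /q; nra.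
Qed.

Definition support_fun (c : 'rV[R]_t) (r : R) u := dot u c + r.

Lemma convex_halfspace u k : @convex_set R 'rV[R]_t [set x | dot u x <= k].
Proof.
move=> x y l; rewrite !inE /= => xk yk; rewrite /conv /= !dotE.
have l0 : 0 <= l%:num by [].
have l1 : l%:num <= 1 by [].
rewrite /onem; nra.
Qed.

(** By Cauchy-Schwarz [dot u] is largest on the ball at [c + r *: u]. *)
Lemma support_fun_sub c r u k : 0 <= r -> dot u u = 1 ->
  solid_sphere c r `<=` [set x | dot u x <= k] <-> support_fun c r u <= k.
Proof.
move=> r0 u1; split=> [|le_k x]; rewrite /solid_sphere /=.
  move=> /(_ (c + r *: u)) /=; rewrite euclidean_distE addrAC subrr add0r.
  by rewrite enormZ (enorm_unit u1) mulr1 ger0_norm // !dotE u1 mulr1; exact.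
rewrite euclidean_distE => /(le_trans (dot_le_enorm _ u1)).
by rewrite !dotE; move: le_k; rewrite /support_fun; lra.
Qed.

(** A point [c + r *: w] with [enorm w <= 1] is a combination of [ca + ra *: w] and [cb + rb *: w],
    which lie in the two balls. *)
Lemma solid_sphere_combination ca cb ra rb l p (C : set 'rV[R]_t) :
  0 <= ra -> 0 <= rb -> 0 <= l <= 1 -> convex_set C ->
  solid_sphere ca ra `<=` C -> solid_sphere cb rb `<=` C ->
  enorm (p - (l *: ca + (1 - l) *: cb)) <= l * ra + (1 - l) * rb -> C p.
Proof.
move=> ra0 rb0 /andP[l0 l1] cC sa sb; set c := l *: ca + _; set r := l * ra + _ => pr.
have [w w1 pE] : exists2 w, enorm w <= 1 & p = c + r *: w.
  have [r0|r0] := eqVneq r 0.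
    exists 0; first by rewrite /enorm dot0l sqrtr0.
    rewrite scaler0 addr0; apply/eqP; rewrite -subr_eq0 -dot_eq0 -sqr_enorm.
    by rewrite sqrf_eq0 eq_le enorm_ge0 andbT -r0.
  have {}r0 : 0 < r by rewrite lt_def r0 /r addr_ge0 ?mulr_ge0 ?subr_ge0.
  exists (r^-1 *: (p - c)); last by rewrite scalerA divff ?gt_eqF // scale1r addrC subrK.
  by rewrite enormZ gtr0_norm ?invr_gt0 // ler_pdivrMl // mulr1.
have in_ball c' r' : 0 <= r' -> solid_sphere c' r' (c' + r' *: w).
  move=> r'0; rewrite /solid_sphere /= euclidean_distE addrAC subrr add0r.
  by rewrite enormZ ger0_norm // ler_piMr.
have := cC (ca + ra *: w) (cb + rb *: w) (Itv01 l0 l1).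
rewrite !inE => /(_ (sa _ (in_ball _ _ ra0)) (sb _ (in_ball _ _ rb0))).
suff <- : p = conv (Itv01 l0 l1) (ca + ra *: w : convex_lmodType 'rV[R]_t)
                                 (cb + rb *: w) by [].
rewrite pE /conv /= /c /r /onem; apply/rowP => i; rewrite !mxE; ring.
Qed.

Lemma continuous_enorm_line (A B : 'rV[R]_t) :
  continuous (fun l : R => enorm (l *: A + (1 - l) *: B)).
Proof.
pose q (l : R) := l * l * dot A A + 2 * (l * (1 - l)) * dot A B
                  + (1 - l) * (1 - l) * dot B B.
rewrite (_ : (fun _ => _) = Num.sqrt \o q); last first.
  apply/funext => l; rewrite /enorm /q /= !dotE (dotC B A); congr Num.sqrt; ring.
move=> l; apply: continuous_comp; last exact: sqrt_continuous.
have l1 : {for l, continuous (fun l : R => 1 - l)}.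
  by apply: cvgB; [exact: cvg_cst|exact: cvg_id].
apply: cvgD; [apply: cvgD|]; (apply: cvgM; last exact: cvg_cst).
- by apply: cvgM; exact: cvg_id.
- apply: cvgM; first exact: cvg_cst.
  by apply: cvgM; [exact: cvg_id|exact: l1].
- by apply: cvgM; exact: l1.
Qed.

(* The hull of two balls is the union of the balls with center [l ca + (1-l) cb] and
   radius [l ra + (1-l) rb]; the separating direction points to [p] from the center
   of the one nearest to [p]. *)
Lemma convex_hull2_separation ca cb ra rb p (C : set 'rV[R]_t) :
  0 <= ra -> 0 <= rb -> convex_set C ->
  solid_sphere ca ra `<=` C -> solid_sphere cb rb `<=` C -> ~ C p ->
  exists u, [/\ dot u u = 1, support_fun ca ra u < dot u p
              & support_fun cb rb u < dot u p].
Proof.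
move=> ra0 rb0 cC sa sb nCp.
pose A := ca - p; pose B := cb - p.
pose m (l : R) := l *: A + (1 - l) *: B.
pose r (l : R) := l * ra + (1 - l) * rb.
have mE l : enorm (p - (l *: ca + (1 - l) *: cb)) = enorm (m l).
  rewrite -enormN; congr enorm; rewrite /m /A /B; apply/rowP => i; rewrite !mxE; ring.
have gap l : 0 <= l <= 1 -> r l < enorm (m l).
  move=> l01; rewrite ltNge; apply/negP => le_r; apply: nCp.
  by apply: (solid_sphere_combination ra0 rb0 l01 cC sa sb); rewrite mE.
have g_cont : {within `[0, 1], continuous (fun l => enorm (m l) - r l)}.
  apply: continuous_subspaceT => l; apply: cvgB; first exact: continuous_enorm_line.
  apply: cvgD; apply: cvgM; try exact: cvg_cst; first exact: cvg_id.
  by apply: cvgB; [exact: cvg_cst|exact: cvg_id].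
have [l + min_l] := EVT_min ler01 g_cont; rewrite in_itv /= => l01.
have /andP[l0 l1] := l01.
have rl0 : 0 <= r l by rewrite addr_ge0 ?mulr_ge0 ?subr_ge0.
have gapl := gap l l01; set M := enorm (m l) in gapl.
have M0 : 0 < M by exact: le_lt_trans gapl.
(* First-order condition at the minimum of [enorm (m l) - r l] when moving towards an endpoint,
   where [m] and [r] take the values [d] and [k]. Strictness comes from [r l < M]. *)
have descent k (d : 'rV[R]_t) :
    (forall e, 0 < e -> e <= 1 -> exists2 l' : R, 0 <= l' <= 1 &
       m l' = m l + e *: (d - m l) /\ r l' = r l + e * (k - r l)) ->
    k * M < dot (m l) d.
  move=> near_l; suff : (k - r l) * M <= dot (m l) (d - m l).
    have := gapl; rewrite -(ltr_pM2r M0) dotDr dotNr -sqr_enorm -/M; lra.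
  apply: enorm_first_order => // e e0 e1.
  have [l' l'01 [<- rE]] := near_l e e0 e1.
  by have := min_l l'; rewrite in_itv /= l'01 rE => /(_ isT); rewrite -/M; lra.
exists (- M^-1 *: m l); split.
- by rewrite dotZl dotZr -sqr_enorm -/M; field; rewrite gt_eqF.
- have : ra * M < dot (m l) A.
    apply: descent => e e0 e1; exists (l + e * (1 - l)); first by apply/andP; nra.
    by split; [apply/rowP => i; rewrite !mxE|rewrite /r]; ring.
  rewrite -ltr_pdivlMr // /support_fun dotZl dotZl dotDr dotNr; lra.
- have : rb * M < dot (m l) B.
    apply: descent => e e0 e1; exists (l - e * l); first by apply/andP; nra.
    by split; [apply/rowP => i; rewrite !mxE|rewrite /r]; ring.
  rewrite -ltr_pdivlMr // /support_fun dotZl dotZl dotDr dotNr; lra.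
Qed.

(* For unit vectors [2 * (1 - dot u v)] is the squared distance, so when [support_fun v k]
   vanishes at a point of the sphere this follows from Ptolemy's inequality for that point
   and [ua, ub, uc].  In general the difference of the two sides is, up to a nonnegative
   factor, the value of [support_fun v k] at another unit vector. *)
Lemma weak_ptolemy ua ub uc v k :
  dot ua ua = 1 -> dot ub ub = 1 -> dot uc uc = 1 ->
  (forall u, dot u u = 1 -> 0 <= support_fun v k u) ->
  (1 - dot ub uc) * support_fun v k ua <=
    2 * ((1 - dot ua uc) * support_fun v k ub + (1 - dot ua ub) * support_fun v k uc).
Proof.
move=> ua1 ub1 uc1 h.
pose T := 2 * (1 - dot ua uc) + 2 * (1 - dot ua ub) - (1 - dot ub uc).
pose V := (2 * (1 - dot ua uc)) *: ub + (2 * (1 - dot ua ub)) *: uc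
          - (1 - dot ub uc) *: ua.
have VV : dot V V = T ^+ 2.
  by rewrite /V !dotE ua1 ub1 uc1 (dotC uc) (dotC ub ua) (dotC uc ua) /T; ring.
(* [T] is half the squared norm of [ub + uc - 2 *: ua]. *)
have T0 : 0 <= T.
  have := dot_ge0 (ub + uc - 2 *: ua).
  rewrite !dotE ua1 ub1 uc1 (dotC uc ub) (dotC ub ua) (dotC uc ua) /T; lra.
have : 0 <= dot V v + T * k.
  have [T0'|T0'] := eqVneq T 0.
    have /eqP -> : V == 0 by rewrite -dot_eq0 VV T0' expr0n.
    by rewrite T0' dot0l mul0r addr0.
  have := h (T^-1 *: V); rewrite dotZl dotZr VV /support_fun dotZl.
  rewrite expr2 mulKf // mulVf // => /(_ erefl).
  by rewrite -(pmulr_rge0 _ (_ : 0 < T)) ?lt_def ?T0' // mulrDr mulVKf.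
by rewrite /V !dotE /T /support_fun; lra.
Qed.

(** Nonnegativity on the unit sphere gives [enorm v <= k]; a zero at [u] is then an equality case of
    Cauchy-Schwarz, [v = - k *: u], and two different zeros force [k = 0]. *)
Lemma support_fun_eq0 ua ub v k :
  dot ua ua = 1 -> dot ub ub = 1 -> ua != ub ->
  (forall u, dot u u = 1 -> 0 <= support_fun v k u) ->
  support_fun v k ua = 0 -> support_fun v k ub = 0 -> v = 0 /\ k = 0.
Proof.
move=> ua1 ub1 neq_ab h fa fb.
have k0 : 0 <= k.
  have := h (- ua); rewrite !dotE opprK ua1 => /(_ erefl).
  by move: fa; rewrite /support_fun !dotE; lra.
have vk : dot v v <= k ^+ 2.
  have [->|v0] := eqVneq v 0; first by rewrite dot0l sqr_ge0.
  have N0 : 0 < enorm v by rewrite sqrtr_gt0 lt_def dot_eq0 v0 dot_ge0.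
  have := h (- (enorm v)^-1 *: v); rewrite /support_fun !dotE -sqr_enorm.
  rewrite (_ : _ * (_ * _) = 1); last by field; rewrite gt_eqF.
  rewrite (_ : _ * _ = - enorm v) => [/(_ erefl)|]; last by field; rewrite gt_eqF.
  by rewrite ler_sqr ?nnegrE ?(ltW N0) //; lra.
have vE u : dot u u = 1 -> support_fun v k u = 0 -> v = - k *: u.
  rewrite /support_fun => u1 f0; apply/eqP; rewrite scaleNr -addr_eq0 -dot_eq0.
  rewrite eq_le dot_ge0 andbT !dotE u1 (dotC v u); nra.
have : k *: ua == k *: ub.
  by rewrite -eqr_opp -!scaleNr -(vE _ ua1 fa) -(vE _ ub1 fb).
rewrite -subr_eq0 -scalerBr scaler_eq0 subr_eq0 (negPf neq_ab) orbF => /eqP k_eq0.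
by rewrite (vE _ ua1 fa) k_eq0 oppr0 scale0r.
Qed.

End Euclidean.

(** * The obstruction *)

Lemma dot_lt1 (R : realType) (t : nat) (u v : 'rV[R]_t) :
  dot u u = 1 -> dot v v = 1 -> u != v -> dot u v < 1.
Proof.
move=> u1 v1; rewrite -subr_eq0 -dot_eq0 => uv.
have : 0 < dot (u - v) (u - v) by rewrite lt_def uv dot_ge0.
by rewrite !dotE u1 v1 (dotC v u); lra.
Qed.

Lemma convex_hull_convex (R : realType) (t : nat) (A : set 'rV[R]_t) :
  @convex_set R 'rV[R]_t (convex_hull A).
Proof.
move=> x y l; rewrite !inE => xA yA K [cK sAK].
by apply/set_mem/cK; rewrite inE; [exact: xA|exact: yA].
Qed.

Lemma representable_supports (R : realType) (t : nat) (X : finType)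
    (phi : {set X} -> {set X}) :
  @sphere_representable R t X phi ->
  exists (c : X -> 'rV[R]_t) (r : X -> R),
    [/\ forall x y, c x = c y -> r x = r y -> x = y,
        forall (Y : {set X}) x u (k : R), dot u u = 1 -> x \in phi Y ->
          (forall y, y \in Y -> support_fun (c y) (r y) u <= k) ->
          support_fun (c x) (r x) u <= k
      & forall a b x, x \notin phi [set a; b]%SET ->
          exists u, [/\ dot u u = 1,
            support_fun (c a) (r a) u < support_fun (c x) (r x) u
            & support_fun (c b) (r b) u < support_fun (c x) (r x) u]].
Proof.
case=> F [F_ball F_inj FP].
have /choice[cr crP] : forall x, exists cr : 'rV[R]_t * R,
    0 <= cr.2 /\ F x = solid_sphere cr.1 cr.2.
  by move=> x; have [c [r r0 FE]] := F_ball x; exists (c, r).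
exists (fst \o cr), (snd \o cr); split=> /=.
- by move=> x y eq_c eq_r; apply: F_inj; rewrite !(proj2 (crP _)) eq_c eq_r.
- move=> Y x u k u1 /FP sub le_k.
  apply/(support_fun_sub _ _ (proj1 (crP x)) u1); rewrite -(proj2 (crP x)).
  apply: subset_trans sub _; apply: smallest_sub; first exact: convex_halfspace.
  apply: bigcup_sub => y /= /le_k h; rewrite (proj2 (crP y)).
  by apply/(support_fun_sub _ _ (proj1 (crP y)) u1).
- move=> a b x /negP nx.
  have /existsNP[p /not_implyP[Fp nCp]] :
      ~ F x `<=` convex_hull (\bigcup_(y in [set` [set a; b]%SET]) F y).
    by move/FP.
  have sub y : y \in [set a; b]%SET ->
      F y `<=` convex_hull (\bigcup_(y in [set` [set a; b]%SET]) F y).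
    by move=> yab; apply: sub_smallest; exact: bigcup_sup.
  have sub_a := sub a (set21 a b); have sub_b := sub b (set22 a b).
  rewrite (proj2 (crP a)) in sub_a; rewrite (proj2 (crP b)) in sub_b.
  have [u [u1 a_lt b_lt]] := convex_hull2_separation (proj1 (crP a)) (proj1 (crP b))
    (@convex_hull_convex _ _ _) sub_a sub_b nCp.
  exists u; suff le_p : dot u p <= support_fun (cr x).1 (cr x).2 u.
    by split; rewrite // (lt_le_trans _ le_p).
  move: p Fp {nCp a_lt b_lt}; rewrite (proj2 (crP x)).
  exact/(support_fun_sub _ _ (proj1 (crP x)) u1).
Qed.

Lemma config_not_representable (R : realType) (t : nat) :
  ~ @sphere_representable R t config (rank_closure config_rank).
Proof.
case/representable_supports=> c [r [cr_inj supp sep]].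
pose h u x := support_fun (c x) (r x) u.
have others (d e : 'I_3) : d != e -> d = e + 1 \/ d = e + 2.
  by case: d e => [[|[|[|//]]] ?] [[|[|[|//]]] ?] // _; (left + right); apply: val_inj.
have next (e : 'I_3) : [/\ e + 1 != e, e + 2 != e & e + 2 != e + 1].
  by case: e => [[|[|[|//]]] ?].
have /choice[u uP] : forall e : 'I_3, exists u, dot u u = 1 /\
    forall d : 'I_3, d != e -> h u (top d) < h u (pt e false ord0).
  move=> e; have /sep[u [u1 ha hb]] : pt e false ord0 \notin
      rank_closure config_rank [set top (e + 1); top (e + 2)]%SET.
    apply/rank_closureP => /(_ e)[y + le_y].
    have [n1 n2 _] := next e.
    have lt3 : (config_rank e y < 3)%N -> False.
      by move=> /(leq_ltn_trans le_y); rewrite /= eqxx.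
    by rewrite !inE => /orP[] /eqP yE; apply: lt3; rewrite yE config_rank_top.
  by exists u; split=> // d /others[] ->.
have u1 (e : 'I_3) : dot (u e) (u e) = 1 by case: (uP e).
have mono e x y : (10 <= config_rank e x)%N -> (config_rank e x <= config_rank e y)%N ->
    h (u e) x <= h (u e) y.
  (* For [e' != e] the element [top e'] is highest in order [e'], so [z] is in the closure of [w]
     and the tops other than [top e]. If [z] exceeds these tops at [u e], the bound must come from
     [w]. The first use, with [z] the lowest point, shows that every [x] of rank at least 10 exceeds
     them. *)
  have base z w : (config_rank e z <= config_rank e w)%N ->
      h (u e) (pt e false ord0) <= h (u e) z \/ z = pt e false ord0 ->
      h (u e) z <= h (u e) w.
    move=> le_zw z_big; rewrite leNgt; apply/negP => lt_wz.
    pose Y := (w |: [set top d | d in [set d | d != e]])%SET.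
    pose k := Num.max (h (u e) w) (Num.max (h (u e) (top (e + 1))) (h (u e) (top (e + 2)))).
    have : h (u e) z <= k.
      apply: (supp Y) => //.
        apply/rank_closureP => e'; have [->|ne] := eqVneq e' e.
          by exists w; rewrite // !inE eqxx.
        exists (top e'); last by rewrite config_rank_topE config_rank_le.
        by rewrite !inE; apply/orP; right; apply: imset_f; rewrite inE.
      move=> v; rewrite !inE => /orP[/eqP->|/imsetP[d]]; first by rewrite !le_max lexx.
      by rewrite inE => /others[] -> ->; rewrite !le_max lexx ?orbT.
    have [n1 n2 _] := next e; have := (uP e).2 _ n1; have := (uP e).2 _ n2.
    move=> hb ha; rewrite !le_max leNgt lt_wz /=.
    case: z_big lt_wz {le_zw} => [le_z|->] _; last by rewrite !leNgt ha hb.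
    by rewrite !leNgt (lt_le_trans ha le_z) (lt_le_trans hb le_z).
  move=> x10 le_xy; apply: (base) => //; left; apply: base; last by right.
  by rewrite /= eqxx /= muln0 !addn0.
have neq_u d e : d != e -> u d != u e.
  have le_top a : h (u a) (pt a false ord0) <= h (u a) (top a).
    by apply: mono; rewrite ?config_rank_topE ?config_rank_le //= eqxx.
  (* In a common direction [top d] and [top e] would each be strictly below the other. *)
  move=> ne; apply/eqP => eq_u.
  have := (uP e).2 _ ne; have := (uP d).2 e; rewrite eq_sym => /(_ ne).
  have := le_top d; have := le_top e; rewrite eq_u; lra.
(* Half the squared distance between the two other directions: the factor of the value at [u e] in
   [weak_ptolemy]. *)
pose w (e : 'I_3) := 1 - dot (u (e + 1)) (u (e + 2)).
have w_gt0 e : 0 < w e.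
  by rewrite subr_gt0 dot_lt1 // neq_u // eq_sym; case: (next e).
pose C e x := w e * h (u e) x.
have hB v d i : support_fun (c (pt d true i) - c (pt d false i))
    (r (pt d true i) - r (pt d false i)) v = h v (pt d true i) - h v (pt d false i).
  by rewrite /h /support_fun !dotE; ring.
(* [pt d false i] lies below [pt d true i] in all three orders. *)
have f_ge0 d i v : dot v v = 1 -> 0 <= support_fun (c (pt d true i) - c (pt d false i))
    (r (pt d true i) - r (pt d false i)) v.
  move=> v1; rewrite hB subr_ge0; apply: (supp [set pt d true i]%SET) => //.
    apply/rank_closureP => e; exists (pt d true i); first by rewrite inE.
    by rewrite /=; case: eqP => _; lia.
  by move=> y; rewrite inE => /eqP ->.
have C_mono e x y : (10 <= config_rank e x)%N -> (config_rank e x <= config_rank e y)%N ->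
    C e x <= C e y.
  by move=> x10 le_xy; rewrite ler_pM2l // mono.
have C_ptolemy (e d i : 'I_3) : C e (pt d true i) - C e (pt d false i) <=
    2 * (C (e + 1) (pt d true i) - C (e + 1) (pt d false i)
         + (C (e + 2) (pt d true i) - C (e + 2) (pt d false i))).
  have := weak_ptolemy (u1 e) (u1 (e + 1)) (u1 (e + 2)) (f_ge0 d i).
  have cyc : [/\ e + 1 + 1 = e + 2, e + 1 + 2 = e, e + 2 + 1 = e & e + 2 + 2 = e + 1].
    by clear; split; apply: val_inj; case: e => [[|[|[|//]]] ?].
  case: cyc => e11 e12 e21 e22.
  have w1 : w (e + 1) = 1 - dot (u e) (u (e + 2)) by rewrite /w e11 e12 dotC.
  have w2 : w (e + 2) = 1 - dot (u e) (u (e + 1)) by rewrite /w e21 e22.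
  by rewrite !hB /C -w1 -w2 -/(w e) !mulrBr.
have zero e : e != ord0 -> h (u e) (pt ord0 true ord0) - h (u e) (pt ord0 false ord0) = 0.
  rewrite eq_sym => /(delta_eq0 C_mono C_ptolemy ord0)/eqP/=.
  by rewrite /C -mulrBr mulf_eq0 gt_eqF //= => /eqP.
have [n1 n2 n3] := next ord0.
(* The difference of the support functions vanishes at two distinct directions, so two different
   points get the same center and radius. *)
have [/eqP + /eqP +] := support_fun_eq0 (u1 _) (u1 _) (neq_u _ _ n3) (f_ge0 ord0 ord0)
  (etrans (hB _ _ _) (zero _ n2)) (etrans (hB _ _ _) (zero _ n1)).
by rewrite !subr_eq0 => /eqP eq_c /eqP /(cr_inj _ _ eq_c).
Qed.

Theorem theorem3p1 (R : realType) :
  exists (X : finType) (phi : {set X} -> {set X}),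
    [/\ convex_geometry phi,
        convex_dimension_is phi 3
      & forall t : nat, (0 < t)%N -> ~ @sphere_representable R t X phi].
Proof.
exists config, (rank_closure config_rank); split.
- exact: rank_convex_geometry config_rank_inj ord0.
- exact: config_dimension.
- by move=> t _; exact: config_not_representable.
Qed.
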